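(* Let $x\in\mathbb{R}^n$ be a local minimum of the nonlinear symmetric cone problem (P1): minimize $f(x)$ subject to $h(x)=0$, $g(x)\in\mathcal{K}$. Assume that $(x,\mu,\lambda)\in\mathbb{R}^n\times\mathbb{R}^m\times\mathcal{E}$ is a KKT triple for (P1) and that $x$ is nondegenerate. Then $$\langle\nabla_x^2L(x,\mu,\lambda)v,v\rangle+2\langle w\circ w,\lambda\rangle\geq0$$ for every $(v,w)\in\mathbb{R}^n\times\mathcal{E}$ such that $Jg(x)v-2\sqrt{g(x)}\circ w=0$ and $Jh(x)v=0$.
   Context: $(\mathcal{E},\circ)$ is a Euclidean Jordan algebra: a finite-dimensional real inner product space with a bilinear product $\circ$ and unit $e$ such that $y\circ z=z\circ y$, $y\circ(y^2\circ z)=y^2\circ(y\circ z)$ (with $y^2=y\circ y$) and $\langle y\circ z,w\rangle=\langle y,z\circ w\rangle$. Every $y\in\mathcal{E}$ has a spectral decomposition $y=\sum_{i=1}^r\sigma_ic_i$ with real eigenvalues $\sigma_i$ (unique up to order) and a Jordan frame $c_1,\dots,c_r$ (primitive idempotents with $c_i\circ c_j=0$ for $i\neq j$ and $\sum_ic_i=e$); $\operatorname{tr}(y)=\sum_i\sigma_i$, and $\langle x,y\rangle=\operatorname{tr}(x\circ y)$. $\mathcal{K}=\{y\circ y\mid y\in\mathcal{E}\}$ is the cone of squares (elements with nonnegative eigenvalues); for $y\in\mathcal{K}$, $\sqrt{y}=\sum_i\sqrt{\sigma_i}\,c_i$. $f:\mathbb{R}^n\to\mathbb{R}$, $h:\mathbb{R}^n\to\mathbb{R}^m$,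 $g:\mathbb{R}^n\to\mathcal{E}$ are twice continuously differentiable; $Jh,Jg$ are the Jacobians (derivatives), $^*$ denotes adjoint. The Lagrangian of (P1) is $L(x,\mu,\lambda)=f(x)-\langle h(x),\mu\rangle-\langle g(x),\lambda\rangle$. A KKT triple $(x,\mu,\lambda)$ of (P1) satisfies $\nabla f(x)-Jh(x)^*\mu-Jg(x)^*\lambda=0$, $\lambda\in\mathcal{K}$, $g(x)\in\mathcal{K}$, $\lambda\circ g(x)=0$, $h(x)=0$. Nondegeneracy: a point $x$ with $g(x)\in\mathcal{K}$ is nondegenerate if $\mathbb{R}^m\times\mathcal{E}=\{(Jh(x)d,Jg(x)d)\mid d\in\mathbb{R}^n\}+\{0\}\times\operatorname{lin}T_{\mathcal{K}}(g(x))$, where $T_{\mathcal{K}}(z)$ is the tangent cone of $\mathcal{K}$ at $z$ and $\operatorname{lin}T=T\cap(-T)$ is the lineality space. *)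

(* Defs.v *)
From HB Require Import structures.
From mathcomp Require Import all_boot all_order all_algebra.
From mathcomp Require Import all_classical all_reals all_analysis.

Set Implicit Arguments.
Unset Strict Implicit.
Unset Printing Implicit Defensive.

Import Order.TTheory GRing.Theory Num.Theory.
Import numFieldNormedType.Exports.

Local Open Scope classical_set_scope.
Local Open Scope ring_scope.

(* A Jordan algebra is only commutative and not associative, and may be {0},
   hence it is not built on top of the ring structures. *)
HB.mixin Record Vector_isJordan (R : realType) E of Vector R E := {
  jmul : E -> E -> E;
  junit : E;
  jmulC : commutative jmul;
  jmul_linearl : forall z, linear (jmul ^~ z);
  jmul1x : left_id junit jmul;
  jordan_identity : forall y z,
    jmul y (jmul (jmul y y) z) = jmul (jmul y y) (jmul y z)
}.

#[short(type="jordanAlgType")]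
HB.structure Definition JordanAlgebra (R : realType) :=
  {E of Vector R E & Vector_isJordan R E}.

Notation "x \o_J y" := (jmul x y)
  (at level 40, left associativity, format "x  \o_J  y") : ring_scope.

Section Spectral.
Context {R : realType} {E : jordanAlgType R}.
Implicit Types (x y c : E).

Definition idempotent_elt c : Prop := c \o_J c = c.

Definition primitive_idempotent c : Prop :=
  [/\ idempotent_elt c, c <> 0 &
      ~ exists a b : E, [/\ idempotent_elt a, idempotent_elt b,
                            a <> 0, b <> 0 & c = a + b]].

Definition jordan_frame (r : nat) (c : 'I_r -> E) : Prop :=
  [/\ forall i, primitive_idempotent (c i),
      forall i j, i <> j -> c i \o_J c j = 0 &
      \sum_i c i = junit].

Definition spectral_decomposition (y : E) (r : nat) (s : 'I_r -> R)
    (c : 'I_r -> E) : Prop :=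
  jordan_frame c /\ y = \sum_i s i *: c i.

(* The values below do not depend on the decomposition, as the eigenvalues and
   the sums of the c_i over equal eigenvalues are unique in a Euclidean Jordan
   algebra; the default 0 is irrelevant, as a decomposition always exists. *)
Definition jtrace (y : E) : R :=
  xget 0 [set t | exists (r : nat) (s : 'I_r -> R) (c : 'I_r -> E),
                    spectral_decomposition y s c /\ t = \sum_i s i].

Definition jsqrt (y : E) : E :=
  xget 0 [set z | exists (r : nat) (s : 'I_r -> R) (c : 'I_r -> E),
                    spectral_decomposition y s c /\
                    z = \sum_i Num.sqrt (s i) *: c i].

Definition cone_of_squares : set E := [set y \o_J y | y in [set: E]].

End Spectral.

HB.mixin Record JordanNormed_isEuclidean (R : realType) E
    of NormedModule R E & JordanAlgebra R E := {
  jdot : E -> E -> R;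
  jdotC : forall x y, jdot x y = jdot y x;
  jdot_linearl : forall y, scalar (jdot ^~ y);
  jdot_ge0 : forall x, 0 <= jdot x x;
  jdot_eq0 : forall x, jdot x x = 0 -> x = 0;
  jnormE : forall x : E, `|x| = Num.sqrt (jdot x x);
  jdot_assoc : forall y z w : E, jdot (y \o_J z) w = jdot y (z \o_J w);
  jdot_trace : forall x y : E, jdot x y = jtrace (x \o_J y)
}.

#[short(type="euclideanJordanType")]
HB.structure Definition EuclideanJordan (R : realType) :=
  {E of NormedModule R E & JordanAlgebra R E & JordanNormed_isEuclidean R E}.

Definition dot (R : realType) (n : nat) (u v : 'rV[R]_n) : R :=
  \sum_i u ord0 i * v ord0 i.

Section Calculus.
Context {R : realType} {n : nat}.

(* As 'rV_n is finite-dimensional, the Frechet derivative is continuous (resp.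
   C1) iff all its evaluations 'D_v F are. *)
Definition C1 (W : normedModType R) (F : 'rV[R]_n -> W) : Prop :=
  (forall x, differentiable F x) /\ (forall v, continuous ('D_v F)).

Definition C2 (W : normedModType R) (F : 'rV[R]_n -> W) : Prop :=
  (forall x, differentiable F x) /\ (forall v, C1 ('D_v F)).

Definition gradient (F : 'rV[R]_n -> R) (x : 'rV[R]_n) : 'rV[R]_n :=
  \row_i 'D_(delta_mx ord0 i) F x.

(* Row-vector convention: the Hessian maps v to v *m hessian F x. *)
Definition hessian (F : 'rV[R]_n -> R) (x : 'rV[R]_n) : 'M[R]_n :=
  'J (gradient F) x.

(* For linear A, the vector representing d |-> ip (A d) y with respect to the
   standard inner product of 'rV_n. *)
Definition adjoint (V : Type) (ip : V -> V -> R) (A : 'rV[R]_n -> V) (y : V) :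
  'rV[R]_n := \row_i ip (A (delta_mx ord0 i)) y.

End Calculus.

Section Cones.
Context {R : realType} {V : normedModType R}.

(* Contingent (Bouligand) cone. *)
Definition tangent_cone (K : set V) (z : V) : set V :=
  [set d | exists (t : nat -> R) (u : nat -> V),
     [/\ forall k, 0 < t k, t @ \oo --> (0 : R), u @ \oo --> d &
         forall k, K (z + t k *: u k)]].

Definition lineality (T : set V) : set V := T `&` [set d | T (- d)].

End Cones.

Section NSCP.
Context {R : realType} {n m : nat} {E : euclideanJordanType R}.
Variables (f : 'rV[R]_n -> R) (h : 'rV[R]_n -> 'rV[R]_m) (g : 'rV[R]_n -> E).

Definition feasible (x : 'rV[R]_n) : Prop := h x = 0 /\ cone_of_squares (g x).

Definition local_minimum (x : 'rV[R]_n) : Prop :=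
  feasible x /\ \forall y \near x, feasible y -> f x <= f y.

Definition lagrangian (x : 'rV[R]_n) (mu : 'rV[R]_m) (lambda : E) : R :=
  f x - dot (h x) mu - jdot (g x) lambda.

Definition kkt_triple (x : 'rV[R]_n) (mu : 'rV[R]_m) (lambda : E) : Prop :=
  [/\ gradient f x - adjoint (@dot R m) ('d h x) mu
        - adjoint (@jdot R E) ('d g x) lambda = 0,
      cone_of_squares lambda,
      cone_of_squares (g x),
      lambda \o_J g x = 0 &
      h x = 0].

Definition nondegenerate_point (x : 'rV[R]_n) : Prop :=
  cone_of_squares (g x) /\
  [set: 'rV[R]_m * E] =
  [set p + q | p in [set ('d h x d, 'd g x d) | d in [set: 'rV[R]_n]]
             & q in [set (0 : 'rV[R]_m)] `*`
                    lineality (tangent_cone cone_of_squares (g x))].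

End NSCP.

(* Main.v *)
(* A point y with y o y = g x certifies g x in the cone of squares, so x together
   with y = sqrt (g x) locally minimizes f subject to h x = 0, g x = y o y.
   Nondegeneracy makes these equality constraints regular at (x, y), because the
   kernel of multiplication by y is orthogonal to the lineality space of the
   tangent cone. Lyusternik's theorem then provides, for each (v, w) in the kernel
   of the linearized constraints, feasible points (x + t v', y + t w') with (v', w')
   arbitrarily close to (v, w); along them the second-order expansion of the
   Lagrangian f - <h, mu> - <g - y o y, lambda>, whose gradient at (x, y) vanishes
   since y o lambda = 0, gives the inequality. *)
Require Import Defs.
From HB Require Import structures.
From mathcomp Require Import all_boot all_order all_algebra.
From mathcomp Require Import ring lra.
From mathcomp Require Import all_classical all_reals all_analysis.
Import Order.TTheory GRing.Theory Num.Theory.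
Import numFieldNormedType.Exports.
Local Open Scope classical_set_scope.
Local Open Scope ring_scope.

Set Implicit Arguments.
Unset Strict Implicit.
Unset Printing Implicit Defensive.

(** * Bilinearity of the Jordan product *)

Section JordanProduct.
Context {R : realType} {E : jordanAlgType R}.
Implicit Types (x y z c : E).

Lemma jmulDl x y z : (x + y) \o_J z = x \o_J z + y \o_J z.
Proof. by have := jmul_linearl z 1 x y; rewrite !scale1r. Qed.

Lemma jmul0x z : 0 \o_J z = 0.
Proof. by apply: (addrI (0 \o_J z)); rewrite -jmulDl !addr0. Qed.

Lemma jmulZl a x z : (a *: x) \o_J z = a *: (x \o_J z).
Proof. by have := jmul_linearl z a x 0; rewrite jmul0x !addr0. Qed.

Lemma jmulDr x y z : x \o_J (y + z) = x \o_J y + x \o_J z.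
Proof. by rewrite jmulC jmulDl ![_ \o_J x]jmulC. Qed.

Lemma jmulZr a x z : x \o_J (a *: z) = a *: (x \o_J z).
Proof. by rewrite jmulC jmulZl [z \o_J x]jmulC. Qed.

Lemma jmulx0 z : z \o_J 0 = 0.
Proof. by rewrite jmulC jmul0x. Qed.

Lemma jmulNl x z : (- x) \o_J z = - (x \o_J z).
Proof. by rewrite -scaleN1r jmulZl scaleN1r. Qed.

Lemma jmulNr x z : x \o_J (- z) = - (x \o_J z).
Proof. by rewrite jmulC jmulNl jmulC. Qed.

Lemma jmul_suml (I : Type) (r : seq I) (P : pred I) (F : I -> E) z :
  (\sum_(i <- r | P i) F i) \o_J z = \sum_(i <- r | P i) F i \o_J z.
Proof.
by elim/big_rec2: _ => [|i y1 y2 _ <-]; rewrite ?jmul0x ?jmulDl.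
Qed.

Lemma jmul_sumr (I : Type) (r : seq I) (P : pred I) (F : I -> E) z :
  z \o_J (\sum_(i <- r | P i) F i) = \sum_(i <- r | P i) z \o_J F i.
Proof. by rewrite jmulC jmul_suml; apply: eq_bigr => i _; rewrite jmulC. Qed.

End JordanProduct.

(** * Idempotents, spectral decompositions and tangent cones under the trace inner product *)

Section JordanDot.
Context {R : realType} {E : euclideanJordanType R}.
Implicit Types (x y z c a b : E).

Lemma jdotDl x y z : jdot (x + y) z = jdot x z + jdot y z.
Proof. by have := jdot_linearl z 1 x y; rewrite scale1r mul1r. Qed.

Lemma jdot0x z : jdot 0 z = 0.
Proof. by apply: (addrI (jdot 0 z)); rewrite -jdotDl !addr0. Qed.

Lemma jdotZl k x z : jdot (k *: x) z = k * jdot x z.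
Proof. by have := jdot_linearl z k x 0; rewrite jdot0x !addr0. Qed.

Lemma jdotDr x y z : jdot x (y + z) = jdot x y + jdot x z.
Proof. by rewrite jdotC jdotDl ![jdot _ x]jdotC. Qed.

Lemma jdotZr k x z : jdot x (k *: z) = k * jdot x z.
Proof. by rewrite jdotC jdotZl [jdot z x]jdotC. Qed.

Lemma jdotx0 z : jdot z 0 = 0.
Proof. by rewrite jdotC jdot0x. Qed.

Lemma jdotNl x z : jdot (- x) z = - jdot x z.
Proof. by rewrite -scaleN1r jdotZl mulN1r. Qed.

Lemma jdotNr x z : jdot x (- z) = - jdot x z.
Proof. by rewrite jdotC jdotNl jdotC. Qed.

Lemma jdot_suml (I : Type) (r : seq I) (P : pred I) (F : I -> E) z :
  jdot (\sum_(i <- r | P i) F i) z = \sum_(i <- r | P i) jdot (F i) z.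
Proof.
by elim/big_rec2: _ => [|i y1 y2 _ <-]; rewrite ?jdot0x ?jdotDl.
Qed.

Lemma jdot_sumr (I : Type) (r : seq I) (P : pred I) (F : I -> E) z :
  jdot z (\sum_(i <- r | P i) F i) = \sum_(i <- r | P i) jdot z (F i).
Proof. by rewrite jdotC jdot_suml; apply: eq_bigr => i _; rewrite jdotC. Qed.

(** Testing against every [z] turns linear identities in [E] into real ones, within reach of
    [lra]. *)
Lemma jdot_inj x y : (forall z, jdot x z = jdot y z) -> x = y.
Proof.
move=> xy; apply/eqP; rewrite -subr_eq0; apply/eqP/jdot_eq0.
by rewrite jdotDl jdotNl xy subrr.
Qed.

Let jE := (@jmulDl R E, @jmulDr R E, @jmulZl R E, @jmulZr R E, @jmulNl R E,
  @jmulNr R E).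
Let dE := (jdotDl, jdotDr, jdotZl, jdotZr, jdotNl, jdotNr).

(* The Jordan identity at [y = c + x] and [z = c]. *)
Lemma jordan_identity_at_idempotent c x : idempotent_elt c ->
  2 *: (c \o_J (c \o_J (c \o_J x))) + c \o_J x + c \o_J (c \o_J (x \o_J x))
    + 2 *: (x \o_J (c \o_J (c \o_J x)))
  = 3 *: (c \o_J (c \o_J x)) + 2 *: ((c \o_J x) \o_J (c \o_J x))
    + c \o_J (x \o_J x).
Proof.
move=> cc; have := jordan_identity (c + x) c; have := jordan_identity x c.
rewrite /idempotent_elt in cc.
rewrite !jE !cc (jmulC x c) (jmulC (c \o_J x) c) (jmulC (x \o_J x) c) ?jE.
rewrite ?cc => -> H; apply: jdot_inj => w.
by move/(congr1 (jdot^~ w)): H; rewrite !dE; lra.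
Qed.

(** Comparing the preceding identity at [x] and at [- x] keeps only the terms of odd degree in [x].
    The polynomial that results has the Peirce eigenvalues 0, 1/2 and 1 as roots. *)
Lemma idempotent_mul_cubic c x : idempotent_elt c ->
  2 *: (c \o_J (c \o_J (c \o_J x))) + c \o_J x = 3 *: (c \o_J (c \o_J x)).
Proof.
move=> cc; have H1 := jordan_identity_at_idempotent x cc.
have := jordan_identity_at_idempotent (- x) cc; rewrite !jE !opprK => H2.
apply: jdot_inj => w.
by move/(congr1 (jdot^~ w)): H1; move/(congr1 (jdot^~ w)): H2; rewrite !dE; lra.
Qed.

(* The multiplication L by an idempotent satisfies 2 L^3 - 3 L^2 + L = 0, so
   that L = L^2 + 4 (L - L^2)^2. *)
Lemma jdot_idempotent_mul c a : idempotent_elt c ->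
  let u := c \o_J a in let d := u - c \o_J u in
  jdot a (c \o_J a) = jdot u u + 4 * jdot d d.
Proof.
move=> cc u d; have adj p q : jdot (c \o_J p) q = jdot p (c \o_J q).
  by rewrite jmulC jdot_assoc.
have key p : 2 * jdot p (c \o_J (c \o_J u)) + jdot p u = 3 * jdot p (c \o_J u).
  by have := congr1 (jdot p) (idempotent_mul_cubic a cc); rewrite !dE.
(* Pairing the cubic relation with [a] and with [u] yields the two linear relations between inner
   products that the final [lra] combines. *)
have := key a; have := key u.
have -> : jdot a (c \o_J (c \o_J u)) = jdot u (c \o_J u) by rewrite -!adj.
have -> : jdot a (c \o_J u) = jdot u u by rewrite -!adj.
have e1 : jdot (c \o_J u) (c \o_J u) = jdot u (c \o_J (c \o_J u)).
  by rewrite adj.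
rewrite /d !dE [jdot (c \o_J u) u]jdotC e1 -/u; lra.
Qed.

Lemma jdot_idempotent_ge0 c a : idempotent_elt c -> 0 <= jdot a (c \o_J a).
Proof.
move=> cc; rewrite jdot_idempotent_mul //.
by rewrite addr_ge0 ?mulr_ge0 ?jdot_ge0.
Qed.

Lemma jdot_idempotent_eq0 c a :
  idempotent_elt c -> jdot a (c \o_J a) = 0 -> c \o_J a = 0.
Proof.
move=> cc; rewrite jdot_idempotent_mul // => /eqP.
rewrite paddr_eq0 ?mulr_ge0 ?jdot_ge0 // => /andP[/eqP + _].
exact: jdot_eq0.
Qed.

(* A nonzero square has nonzero trace [jdot x x], whereas [jtrace] would be the
   default 0 if there were no spectral decomposition. *)
Lemma square_spectral (x : E) : exists r (s : 'I_r -> R) (c : 'I_r -> E),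
  spectral_decomposition (x \o_J x) s c.
Proof.
have key (y : E) : y <> 0 -> exists r (s : 'I_r -> R) (c : 'I_r -> E),
    spectral_decomposition (y \o_J y) s c.
  move=> y0; have := jdot_trace y y; rewrite /jtrace.
  case: xgetP => [t _ [r [s [c [H _]]]] _|_ /jdot_eq0 //].
  by exists r, s, c.
have [x0|/eqP /key //] := eqVneq x 0.
(* The zero vector borrows the frame of the square of [junit], with all eigenvalues set to 0; if
   [junit = 0], the empty frame serves. *)
rewrite x0 jmul0x; have [e0|/eqP /key] := eqVneq (junit : E) 0.
  exists 0%N, (fun=> 0), (fun=> 0); split; last by rewrite big_ord0.
  by split => [[]|[]|] //; rewrite big_ord0.
move=> [r [s [c [fr _]]]]; exists r, (fun=> 0), c; split => //.
by rewrite big1 // => i _; rewrite scale0r.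
Qed.

Lemma spectral_mul r (s t : 'I_r -> R) (c : 'I_r -> E) : jordan_frame c ->
  (\sum_i s i *: c i) \o_J (\sum_i t i *: c i) = \sum_i (s i * t i) *: c i.
Proof.
move=> [prim orth _]; rewrite jmul_suml; apply: eq_bigr => i _.
rewrite jmul_sumr (bigD1 i) //= big1 ?addr0 => [|j /eqP ji].
  by case: (prim i) => cc _ _; rewrite jmulZl jmulZr cc scalerA.
by rewrite jmulZl jmulZr orth ?scaler0 // => ij; apply: ji.
Qed.

(** Pairing [z = b \o_J b] with [c i] isolates [s i] times the positive number [jdot (c i) (c i)],
    and the pairing equals [jdot b (c i \o_J b)], which is nonnegative. *)
Lemma eigenvalue_ge0 (z : E) r (s : 'I_r -> R) (c : 'I_r -> E) :
  cone_of_squares z -> spectral_decomposition z s c -> forall i, 0 <= s i.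
Proof.
move=> [b _ <-] [[prim orth sum1] zE] i; have [cc c0 _] := prim i.
have cp : 0 < jdot (c i) (c i).
  by rewrite lt_def jdot_ge0 andbT; apply/eqP => /jdot_eq0.
rewrite -(pmulr_lge0 _ cp) -jdotZl.
have -> : jdot (s i *: c i) (c i) = jdot (b \o_J b) (c i).
  rewrite zE jdot_suml (bigD1 i) //= big1 ?addr0 // => j /eqP ji.
  rewrite jdotZl -[in X in jdot _ X]cc -jdot_assoc orth ?jdot0x ?mulr0 //.
by rewrite jdot_assoc [b \o_J c i]jmulC jdot_idempotent_ge0.
Qed.

(* [t] lists the eigenvalues of [jsqrt z]. *)
Lemma jsqrt_spectral (z : E) : cone_of_squares z ->
  exists r (t : 'I_r -> R) (c : 'I_r -> E),
    [/\ forall i, 0 <= t i, spectral_decomposition (jsqrt z) t c &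
        spectral_decomposition z (fun i => t i ^+ 2) c].
Proof.
move=> Kz; rewrite /jsqrt; case: xgetP => [y _ [r [s [c [sd ->]]]]|].
  have s0 := eigenvalue_ge0 Kz sd.
  exists r, (fun i => Num.sqrt (s i)), c; split.
  - by move=> i; rewrite sqrtr_ge0.
  - by split => //; case: sd.
  - split; first by case: sd.
    by case: sd => _ ->; apply: eq_bigr => i _; rewrite sqr_sqrtr.
(* The default value of [xget] never occurs: [square_spectral] supplies a decomposition. *)
case: Kz => b _ <-; have [r [s [c sd]]] := square_spectral b.
by move=> /(_ (\sum_i Num.sqrt (s i) *: c i)) []; exists r, s, c.
Qed.

Lemma jsqrt_sqr (z : E) : cone_of_squares z -> jsqrt z \o_J jsqrt z = z.
Proof.
move=> /jsqrt_spectral [r [t [c [_ [fr yE] [_ zE]]]]].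
by rewrite {3}zE yE spectral_mul.
Qed.

(* A nonnegative combination of the positive semidefinite multiplications by
   [c i] annihilates only vectors annihilated by each of them. *)
Lemma spectral_ker r (s : 'I_r -> R) (c : 'I_r -> E) (u : E) :
  jordan_frame c -> (forall i, 0 <= s i) ->
  (\sum_i s i *: c i) \o_J u = 0 -> forall i, s i *: (c i \o_J u) = 0.
Proof.
move=> [prim _ _] s0 /(congr1 (jdot u)).
rewrite jdotx0 jmul_suml jdot_sumr => /eqP.
have ge0 i : 0 <= jdot u (c i \o_J u).
  by have [cc _ _] := prim i; rewrite jdot_idempotent_ge0.
rewrite psumr_eq0 => [/allP H i|i _]; last by rewrite jmulZl jdotZr mulr_ge0.
have := H i (mem_index_enum i); rewrite /= jmulZl jdotZr mulf_eq0.
move=> /orP[/eqP ->|/eqP]; first by rewrite scale0r.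
by have [cc _ _] := prim i; move/(jdot_idempotent_eq0 cc) => ->; rewrite scaler0.
Qed.

(** Both elements are diagonal in one frame, with eigenvalues [t i ^+ 2] and [t i] that vanish
    together; by [spectral_ker] the kernel depends only on which of them vanish. *)
Lemma jsqrt_ker (z u : E) : cone_of_squares z ->
  z \o_J u = 0 <-> jsqrt z \o_J u = 0.
Proof.
move=> /jsqrt_spectral [r [t [c [t0 [fr ->] [_ ->]]]]]; split => H.
  rewrite jmul_suml big1 // => i _; rewrite jmulZl.
  have /eqP := spectral_ker fr (fun i => sqr_ge0 (t i)) H i.
  by rewrite scaler_eq0 sqrf_eq0 -scaler_eq0 => /eqP.
rewrite jmul_suml big1 // => i _.
by rewrite jmulZl expr2 -scalerA (spectral_ker fr t0 H) scaler0.
Qed.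

(** A spectral decomposition of [a] with nonnegative eigenvalues reduces the claim to an idempotent,
    whose multiplication is positive semidefinite. *)
Lemma cone_dot_ge0 (a b : E) :
  cone_of_squares a -> cone_of_squares b -> 0 <= jdot a b.
Proof.
move=> Ka [x _ <-]; have [r [t [c [_ _ [fr ->]]]]] := jsqrt_spectral Ka.
rewrite jdot_suml sumr_ge0 // => i _; rewrite jdotZl mulr_ge0 ?sqr_ge0 //.
case: fr => prim _ _; have [cc _ _] := prim i.
by rewrite jdotC jdot_assoc [x \o_J c i]jmulC jdot_idempotent_ge0.
Qed.

Lemma normr_jdot (a b : E) : `|jdot a b| <= `|a| * `|b|.
Proof.
rewrite !jnormE; have [a0|a0] := eqVneq (jdot a a) 0.
  by rewrite (jdot_eq0 _ a0) jdot0x normr0 mulr_ge0 ?sqrtr_ge0.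
have ap : 0 < jdot a a by rewrite lt_def a0 jdot_ge0.
rewrite -sqrtrM ?jdot_ge0 // -sqrtr_sqr ler_wsqrtr //.
have := jdot_ge0 (jdot a a *: b - jdot a b *: a).
rewrite !dE [jdot b a]jdotC => H.
have : 0 <= jdot a a * (jdot a a * jdot b b - jdot a b ^+ 2) by lra.
by rewrite pmulr_rge0 // subr_ge0.
Qed.

Lemma jdot_cvg (u : nat -> E) (d p : E) :
  u @ \oo --> d -> (fun k => jdot (u k) p) @ \oo --> jdot d p.
Proof.
move=> /cvgrPdist_lt ud; apply/cvgrPdist_lt => e e0.
have p0 : 0 < `|p| + 1 by rewrite ltr_wpDl.
have := ud _ (divr_gt0 e0 p0); apply: filterS => k.
rewrite ltr_pdivlMr // => H.
rewrite -jdotNl -jdotDl (le_lt_trans (normr_jdot _ _)) //.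
by apply: le_lt_trans H; rewrite ler_wpM2l // lerDl.
Qed.

(** As [p] is orthogonal to [z], pairing the cone points [z + t u] with [p] and dividing by [t > 0]
    gives [0 <= jdot u p], which passes to the limit. *)
Lemma tangent_dot_ge0 (z d p : E) : cone_of_squares p -> jdot z p = 0 ->
  tangent_cone cone_of_squares z d -> 0 <= jdot d p.
Proof.
move=> Kp zp [t [u [t0 _ ud Ku]]].
have H := jdot_cvg (p := p) ud.
rewrite -(cvg_lim _ H) //; apply: limr_ge; first by apply/cvg_ex; eexists; exact: H.
apply: nearW => k; have := cone_dot_ge0 (Ku k) Kp.
by rewrite jdotDl zp add0r jdotZl pmulr_rge0.
Qed.

(* With c0 the sum of the frame elements of eigenvalue 0, [4 q] is the
   difference of the squares of [q + c0] and [q - c0], both orthogonal to z. *)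
Lemma ker_jsqrt_lineality (z q l : E) : cone_of_squares z ->
  jsqrt z \o_J q = 0 ->
  lineality (tangent_cone cone_of_squares z) l -> jdot l q = 0.
Proof.
move=> Kz yq [Tl Tnl]; have [r [t [c [t0 [fr yE] [_ zE]]]]] := jsqrt_spectral Kz.
(* Both [l] and [- l] are tangent, so the inequality holds with both signs. *)
have orth (p : E) : cone_of_squares p -> jdot z p = 0 -> jdot l p = 0.
  move=> Kp zp; apply/eqP; rewrite eq_le (tangent_dot_ge0 Kp zp Tl) andbT.
  by rewrite -oppr_ge0 -jdotNl (tangent_dot_ge0 Kp zp Tnl).
pose c0 := \sum_(i | t i == 0) c i.
(* Every [c i] with [t i != 0] annihilates [q], so [c0] acts on [q] like the unit. *)
have c0q : c0 \o_J q = q.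
  case: (fr) => _ _ e1; rewrite -[RHS]jmul1x -e1 (bigID (fun i => t i == 0)) /=.
  rewrite jmulDl [X in _ = _ + X](_ : _ = 0) ?addr0 // jmul_suml big1 // => i ti.
  rewrite yE in yq; have /eqP := spectral_ker fr t0 yq i.
  by rewrite scaler_eq0 (negPf ti) => /eqP.
have yc0 : jsqrt z \o_J c0 = 0.
  rewrite yE; have -> : c0 = \sum_i (t i == 0)%:R *: c i.
    rewrite /c0 big_mkcond; apply: eq_bigr => i _.
    by case: eqP; rewrite (scale1r, scale0r).
  rewrite spectral_mul // big1 // => i _.
  by case: eqP => [->|_]; rewrite (mul0r, mulr0) scale0r.
have H (a : E) : jsqrt z \o_J a = 0 -> jdot l (a \o_J a) = 0.
  move=> /(jsqrt_ker a Kz) za; apply: orth; first by exists a.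
  by rewrite -jdot_assoc za jdot0x.
have Hp : jsqrt z \o_J (q + c0) = 0 by rewrite jmulDr yq yc0 addr0.
have Hm : jsqrt z \o_J (q - c0) = 0 by rewrite jmulDr jmulNr yq yc0 subrr.
move: (H _ Hp) (H _ Hm); rewrite !jE [q \o_J c0]jmulC c0q !dE; lra.
Qed.

End JordanDot.

(** * Dual families and Lyusternik's theorem for finitely many equations *)

HB.instance Definition _ (R : realType) (m n : nat) := Complete.on 'M[R]_(m, n).

Lemma scalar_sum (R : realType) (X : lmodType R) (f : X -> R) (I : Type)
    (r : seq I) (k : I -> R) (x : I -> X) : scalar f ->
  f (\sum_(i <- r) k i *: x i) = \sum_(i <- r) k i * f (x i).
Proof.
move=> lf; elim/big_rec2: _ => [|i y1 y2 _ <-]; last by rewrite lf.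
by apply: (addrI (f 0)); have := lf 1 0 0; rewrite scale1r mul1r !addr0.
Qed.

(** The matrix of the values of the [A i] on a basis has independent rows, hence a right inverse
    [N], whose columns are the coordinates of the [beta j]. *)
Lemma dual_family (R : realType) (X : vectType R) (q : nat)
    (A : 'I_q -> X -> R) : (forall i, scalar (A i)) ->
  (forall r : 'rV[R]_q, (forall x, \sum_i r ord0 i * A i x = 0) -> r = 0) ->
  exists beta : 'I_q -> X, forall i j, A i (beta j) = (i == j)%:R.
Proof.
move=> lA freeA; pose b := vbasis {:X}.
pose M : 'M[R]_(q, \dim {:X}) := \matrix_(i, l) A i b`_l.
have /row_freeP[N MN] : row_free M.
  rewrite -kermx_eq0; apply/eqP/row_matrixP => l; rewrite row0.
  have /sub_kermxP : (row l (kermx M) <= kermx M)%MS by apply: row_sub.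
  set r := row l _ => rM; apply: freeA => x.
  transitivity (\sum_i \sum_l r ord0 i * (coord b l x * A i b`_l)).
    apply: eq_bigr => i _; rewrite -mulr_sumr -scalar_sum //.
    by rewrite -(coord_vbasis (memvf x)).
  rewrite exchange_big big1 //= => k _; move/matrixP/(_ ord0 k): rM.
  rewrite mxE [RHS]mxE => rM; transitivity (coord b k x * (\sum_i r ord0 i * M i k)).
    by rewrite mulr_sumr; apply: eq_bigr => i _; rewrite !mxE mulrCA.
  by rewrite rM mulr0.
exists (fun j => \sum_l N l j *: b`_l) => i j; rewrite scalar_sum //.
move/matrixP/(_ i j): MN; rewrite !mxE => <-.
by apply: eq_bigr => l _; rewrite mxE mulrC.
Qed.

Lemma mx_norm_leP (R : realType) (m n : nat) (M : 'M[R]_(m, n)) (e : R) :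
  0 <= e -> reflect (forall i j, `|M i j| <= e) (`|M| <= e).
Proof.
move=> e0; rewrite [X in X <= _]/Num.norm /= mx_normrE.
apply: (iffP idP) => [/bigmax_leP[_ H] i j|H]; first exact: (H (i, j)).
by apply/bigmax_leP; split.
Qed.

Lemma ler_mx_norm_entry (R : realType) (m n : nat) (M : 'M[R]_(m, n)) i j :
  `|M i j| <= `|M|.
Proof. exact: (elimT (mx_norm_leP M (normr_ge0 M)) (lexx _)). Qed.

(** Both [a] and [b] vary near [x0]: this uniformity, stronger than differentiability at [x0], is
    what makes the simplified Newton map contract. *)
Definition strictly_differentiable (R : realType) (X : normedModType R)
    (F A : X -> R) (x0 : X) : Prop :=
  forall eta : R, 0 < eta -> \forall d \near 0^'+, forall a b : X,
    `|a - x0| <= d -> `|b - x0| <= d ->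
    `|F a - F b - A (a - b)| <= eta * `|a - b|.

(* Solutions are sought in the form [x0 + t (V + sum_j rho_j beta_j)], where
   [rho] is a fixed point of the simplified Newton map
   [rho |-> rho - F (x0 + t (V + sum_j rho_j beta_j)) / t], a contraction of
   a small ball. *)
Lemma lyusternik (R : realType) (X : normedModType R) (q : nat)
    (F A : 'I_q -> X -> R) (x0 V : X) (beta : 'I_q -> X) :
  (forall i, scalar (A i)) ->
  (forall i, strictly_differentiable (F i) (A i) x0) ->
  (forall i, F i x0 = 0) -> (forall i, A i V = 0) ->
  (forall i j, A i (beta j) = (i == j)%:R) ->
  forall eps : R, 0 < eps -> \forall t \near 0^'+,
    exists2 V', `|V' - V| <= eps & forall i, F i (x0 + t *: V') = 0.
Proof.
move=> lA sF F0 AV Ab eps eps0.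
pose B (rho : 'rV[R]_q) : X := \sum_j rho ord0 j *: beta j.
pose C : R := \sum_j `|beta j|.
have C0 : 0 <= C by apply: sumr_ge0.
have BC rho : `|B rho| <= C * `|rho|.
  rewrite /B /C mulr_suml (le_trans (ler_norm_sum _ _ _)) // ler_sum // => j _.
  by rewrite normrZ mulrC ler_wpM2l ?ler_mx_norm_entry.
have BB rho rho' : B rho - B rho' = B (rho - rho').
  rewrite /B -sumrB; apply: eq_bigr => j _.
  by rewrite !mxE scalerBl.
have AB i rho : A i (B rho) = rho ord0 i.
  rewrite /B scalar_sum // (bigD1 i) //= Ab eqxx mulr1 big1 ?addr0 // => j ji.
  by rewrite Ab eq_sym (negPf ji) mulr0.
have AZ i k x : A i (k *: x) = k * A i x.
  by have := scalar_sum (index_enum 'I_1) (fun=> k) (fun=> x) (lA i); rewrite !big_ord1.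
(* Radius for [rho] that keeps [B rho] within [eps]; the 1 guards against [C = 0]. *)
pose e := eps / (C + 1).
have C1 : 0 < C + 1 by rewrite ltr_wpDl.
have e0 : 0 < e by rewrite divr_gt0.
have Ce : C * e <= eps.
  by rewrite /e mulrA ler_pdivrMr // mulrC ler_wpM2l ?ltW // ltrDl.
(* The first bound gives the Newton map Lipschitz constant 1/2, the second gives [|T 0| <= e / 2];
   together they send the ball of radius [e] into itself. *)
pose eta := Num.min (2^-1 / (C + 1)) (e / 2 / (`|V| + 1)).
have V1 : 0 < `|V| + 1 by rewrite ltr_wpDl.
have eta0 : 0 < eta by rewrite lt_min !divr_gt0.
have etaC : eta * C <= 2^-1.
  apply: (@le_trans _ _ (eta * (C + 1))); first by rewrite ler_wpM2l ?ltW ?ltrDl.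
  by rewrite -ler_pdivlMr // ge_min lexx.
have etaV : eta * `|V| <= e / 2.
  apply: (@le_trans _ _ (eta * (`|V| + 1))); first by rewrite ler_wpM2l ?ltW ?ltrDl.
  by rewrite -ler_pdivlMr // ge_min lexx orbT.
have [d d0 dP] : exists2 d : R, 0 < d & forall i (a b : X),
    `|a - x0| <= d -> `|b - x0| <= d ->
    `|F i a - F i b - A i (a - b)| <= eta * `|a - b|.
  near (0 : R)^'+ => d; exists d; first by near: d; exact: nbhs_right_gt.
  by near: d; apply: filter_forall => i; exact: sF.
have Ve : 0 < `|V| + eps by rewrite ltr_wpDl.
near=> t.
have t0 : 0 < t by near: t; exact: nbhs_right_gt.
have td : t * (`|V| + eps) <= d.
  rewrite -ler_pdivlMr //; near: t; apply: nbhs_right_le.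
  by rewrite divr_gt0.
pose U : set 'rV[R]_q := closed_ball_ Num.norm 0 e.
pose P rho := x0 + t *: (V + B rho).
have UB rho : U rho -> `|B rho| <= eps.
  rewrite /U /closed_ball_ /= sub0r normrN => H.
  by apply: le_trans (BC _) _; apply: le_trans _ Ce; rewrite ler_wpM2l.
have Pd rho : U rho -> `|P rho - x0| <= d.
  move=> /UB H; rewrite /P addrC addKr normrZ gtr0_norm //.
  apply: le_trans _ td; apply: ler_wpM2l; first exact: ltW.
  by apply: le_trans (ler_normD _ _) _; rewrite lerD2l.
pose T (rho : 'rV[R]_q) : 'rV[R]_q := \row_i (rho ord0 i - t^-1 * F i (P rho)).
have contr rho rho' : U rho -> U rho' -> `|T rho - T rho'| <= 2^-1 * `|rho - rho'|.
  move=> Ur Ur'; apply/mx_norm_leP; first by rewrite mulr_ge0.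
  move=> i0 i; rewrite !mxE.
  (* As [A i (B rho)] is the entry [i] of [rho], the linear parts cancel and only the strict
     differentiability error, divided by [t], remains. *)
  have PP : P rho - P rho' = t *: B (rho - rho').
    by rewrite /P opprD addrACA subrr add0r -scalerBr opprD addrACA subrr add0r BB.
  have := dP i _ _ (Pd _ Ur) (Pd _ Ur'); rewrite PP AZ AB normrZ gtr0_norm // !mxE.
  set f1 := F i _; set f2 := F i _ => H.
  rewrite (_ : _ - _ = - (t^-1 * (f1 - f2 - t * (rho ord0 i - rho' ord0 i)))); last first.
    by field; rewrite gt_eqF.
  rewrite normrN normrM gtr0_norm ?invr_gt0 // mulrC ler_pdivrMr //.
  apply: le_trans H _; rewrite mulrCA mulrC; apply: ler_wpM2r; first exact: ltW.
  apply: le_trans (ler_wpM2l (ltW eta0) (BC _)) _.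
  by rewrite mulrA ler_wpM2r.
have U0 : U 0 by rewrite /U /closed_ball_ /= subrr normr0 ltW.
have T0 : `|T 0| <= e / 2.
  apply/mx_norm_leP; first by rewrite divr_ge0 // ltW.
  move=> i0 i; rewrite !mxE sub0r normrN normrM gtr0_norm ?invr_gt0 //.
  have B0 : B 0 = 0 by rewrite /B big1 // => j _; rewrite mxE scale0r.
  have x0d : `|x0 - x0| <= d by rewrite subrr normr0 ltW.
  have := dP i _ _ (Pd _ U0) x0d.
  rewrite F0 {2 3}/P B0 addr0 [x0 + _]addrC addrK AZ AV mulr0 !subr0 => H.
  rewrite mulrC ler_pdivrMr //; apply: le_trans H _.
  by rewrite normrZ gtr0_norm // mulrCA mulrC ler_wpM2r // ltW.
have TU : set_fun U U T.
  move=> rho Ur; rewrite /U /closed_ball_ /= sub0r normrN.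
  rewrite -[T rho](subrK (T 0)) (le_trans (ler_normD _ _)) //.
  rewrite [leRHS](splitr e) lerD // (le_trans (contr _ _ Ur U0)) //.
  rewrite mulrC ler_wpM2r // subr0.
  by move: Ur; rewrite /U /closed_ball_ /= sub0r normrN.
have cT : is_contraction (mkfun_fun TU).
  exists (2^-1)%:nng; split; first by rewrite /= invf_lt1 // ltr1n.
  by move=> [r r'] /= [Ur Ur']; apply: contr.
have clU : closed U by exact: closed_closed_ball_.
(* In the fixed point equation [rho] cancels, leaving [t^-1 * F i (P rho) = 0]. *)
have [rho Ur /rowP rhoE] := banach_fixed_point cT clU (ex_intro _ 0 U0).
exists (V + B rho); first by rewrite addrC addKr UB.
move=> i; have := rhoE i; rewrite mxE => /eqP.
rewrite eq_sym subr_eq addrC -subr_eq subrr eq_sym mulf_eq0 invr_eq0.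
by rewrite gt_eqF // => /eqP.
Unshelve. all: by end_near. Qed.

(** * Stability of C1 and C2 maps under sums and continuous linear maps *)

Section C1Closure.
Context {R : realType} {n : nat} {W Z : normedModType R}.
Implicit Types (F G : 'rV[R]_n -> W).

Lemma differentiable_comp_linear (T : {linear W -> Z}) F x :
  continuous T -> differentiable F x -> differentiable (T \o F) x.
Proof.
by move=> cT dF; apply: differentiable_comp => //; exact: linear_differentiable.
Qed.

Lemma derive_comp_linear (T : {linear W -> Z}) F x v :
  continuous T -> differentiable F x -> 'D_v (T \o F) x = T ('D_v F x).
Proof.
move=> cT dF; rewrite !deriveE //; last exact: differentiable_comp_linear.
rewrite diff_comp //=; last exact: linear_differentiable.
by rewrite diff_lin.
Qed.

Lemma C1_comp_linear (T : {linear W -> Z}) F :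
  continuous T -> C1 F -> C1 (T \o F).
Proof.
move=> cT [dF cF]; split=> [x|v x]; first exact: differentiable_comp_linear.
have -> : 'D_v (T \o F) = T \o 'D_v F.
  by apply/funext => y; exact: derive_comp_linear.
by apply: continuous_comp; [exact: cF|exact: cT].
Qed.

Lemma C2_comp_linear (T : {linear W -> Z}) F :
  continuous T -> C2 F -> C2 (T \o F).
Proof.
move=> cT [dF c1F]; split=> [x|v]; first exact: differentiable_comp_linear.
have -> : 'D_v (T \o F) = T \o 'D_v F.
  by apply/funext => y; exact: derive_comp_linear.
exact: C1_comp_linear.
Qed.

Lemma C1D F G : C1 F -> C1 G -> C1 (F + G).
Proof.
move=> [dF cF] [dG cG]; split=> [x|v x]; first exact: differentiableD.
have -> : 'D_v (F + G) = 'D_v F + 'D_v G.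
  by apply/funext => y; rewrite deriveD //; exact: diff_derivable.
by apply: continuousD; [exact: cF|exact: cG].
Qed.

Lemma C2D F G : C2 F -> C2 G -> C2 (F + G).
Proof.
move=> [dF cF] [dG cG]; split=> [x|v]; first exact: differentiableD.
have -> : 'D_v (F + G) = 'D_v F + 'D_v G.
  by apply/funext => y; rewrite deriveD //; exact: diff_derivable.
exact: C1D.
Qed.

Lemma C2_C1 F : C2 F -> C1 F.
Proof.
by move=> [dF cF]; split=> // v x; apply: differentiable_continuous; case: (cF v).
Qed.

End C1Closure.

(** * Inner products with a fixed vector as continuous linear maps *)

Section DotForms.
Context {R : realType}.

(** The arguments of [dot] are swapped so that partial application is a linear map to be composed
    with [h]; [jdotr] does the same for [g]. *)
Definition dotr (m : nat) (p u : 'rV[R]_m) : R := dot u p.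

Lemma dotr_is_linear m (p : 'rV[R]_m) : linear (dotr p).
Proof.
move=> a u v; rewrite /dotr /dot scaler_sumr -big_split /=.
by apply: eq_bigr => i _; rewrite !mxE mulrDl -mulrA.
Qed.

HB.instance Definition _ m (p : 'rV[R]_m) :=
  GRing.isLinear.Build R 'rV[R]_m R *:%R (dotr p) (@dotr_is_linear m p).

Lemma normr_dot m (u p : 'rV[R]_m) : `|dot u p| <= (\sum_i `|p ord0 i|) * `|u|.
Proof.
rewrite /dot (le_trans (ler_norm_sum _ _ _)) // mulr_suml ler_sum // => i _.
by rewrite normrM mulrC ler_wpM2l // ler_mx_norm_entry.
Qed.

Lemma dotr_continuous m (p : 'rV[R]_m) : continuous (dotr p).
Proof.
apply/linear_bounded_continuous/linear_boundedP => /=.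
near=> r => u; apply: le_trans (normr_dot _ _) _.
by rewrite ler_wpM2r.
Unshelve. all: by end_near. Qed.

Definition jdotr (E : euclideanJordanType R) (q u : E) : R := jdot u q.

Lemma jdotr_is_linear (E : euclideanJordanType R) (q : E) : linear (jdotr q).
Proof. by move=> a u v; rewrite /jdotr jdotDl jdotZl. Qed.

HB.instance Definition _ (E : euclideanJordanType R) (q : E) :=
  GRing.isLinear.Build R E R *:%R (jdotr q) (@jdotr_is_linear E q).

Lemma jdotr_continuous (E : euclideanJordanType R) (q : E) :
  continuous (jdotr q).
Proof.
apply/linear_bounded_continuous/linear_boundedP => /=.
near=> r => u; apply: le_trans (normr_jdot _ _) _.
by rewrite mulrC ler_wpM2r.
Unshelve. all: by end_near. Qed.

End DotForms.

(** * Mean value estimates to first and second order *)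

Section MeanValue.
Context {R : realType} {n : nat}.
Implicit Types (phi : 'rV[R]_n -> R) (a u v : 'rV[R]_n).

Lemma derive_gradient phi a u : differentiable phi a ->
  'D_u phi a = dot (gradient phi a) u.
Proof.
move=> dphi; rewrite deriveE // [in LHS](row_sum_delta u) linear_sum /=.
by apply: eq_bigr => i _; rewrite linearZ /= mxE deriveE // mulrC.
Qed.

Lemma is_derive_line phi a u (s : R) : differentiable phi (a + s *: u) ->
  is_derive s 1 (fun s => phi (a + s *: u)) ('D_u phi (a + s *: u)).
Proof.
move=> dphi.
have dq : (fun h : R => h^-1 *: (((fun s => phi (a + s *: u)) \o shift s) (h *: 1)
      - phi (a + s *: u))) =
    (fun h : R => h^-1 *: ((phi \o shift (a + s *: u)) (h *: u) - phi (a + s *: u))).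
  apply/funext => h /=; congr (_ *: (phi _ - _)).
  by rewrite [h *: 1]mulr1 scalerDl addrCA.
split; first by rewrite /derivable dq; exact: diff_derivable.
by rewrite /derive dq.
Qed.

(** The function [phi (a + s u) + k s^2] is used on [[0, 1]]: [k = 0] is the classical case, and a
    general [k] carries the slack term of the second-order estimate. *)
Lemma MVT_line phi a u (k : R) : (forall x, differentiable phi x) ->
  exists2 s, 0 < s < 1 &
    phi (a + u) - phi a + k = 'D_u phi (a + s *: u) + 2 * s * k.
Proof.
move=> dphi; pose f (s : R) := phi (a + s *: u) + k * s ^+ 2.
have df (s : R) : is_derive s 1 f ('D_u phi (a + s *: u) + 2 * s * k).
  have H1 := is_derive_line (dphi (a + s *: u)).
  by apply: is_derive_eq; rewrite /GRing.scale /=; ring.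
have [|s] := MVT (ltr01 : 0 < 1 :> R) (fun s _ => df s).
  by apply: derivable_within_continuous => s _; case: (df s).
rewrite in_itv => s01 fE; exists s => //.
transitivity (f 1 - f 0); last by rewrite fE subr0 mulr1.
rewrite /f (scale1r u) (scale0r u) addr0 expr1n.
have -> : (0 : R) ^+ 2 = 0 by rewrite expr0n.
by rewrite mulr0 mulr1 addr0 addrAC.
Qed.

(** The increment is a directional derivative at a point of the segment from [y] to [x]. Balls are
    convex, so that point is near [a] and its partial derivatives are close to those at [a]. *)
Lemma C1_strictly_differentiable phi a : C1 phi ->
  strictly_differentiable phi (fun u => 'D_u phi a) a.
Proof.
(* The successor keeps [N] positive when [n = 0]. *)
move=> [dphi cphi] eta eta0; pose N : R := n.+1%:R.
have N0 : 0 < N by rewrite ltr0n.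
have near_a i : \forall d \near (0 : R)^'+, forall x : 'rV[R]_n, `|x - a| <= d ->
    `|'D_(delta_mx ord0 i) phi x - 'D_(delta_mx ord0 i) phi a| <= eta / N.
  have /cvgrPdist_le/(_ _ (divr_gt0 eta0 N0))/nbhs_normP[e /= e0 eP] :=
    cphi (delta_mx ord0 i) a.
  near=> d => x xa; rewrite distrC; apply: eP => /=.
  rewrite /ball_ /= distrC; apply: le_lt_trans xa _; near: d; exact: nbhs_right_lt.
have [d d0 dP] : exists2 d : R, 0 < d & forall i (x : 'rV[R]_n), `|x - a| <= d ->
    `|'D_(delta_mx ord0 i) phi x - 'D_(delta_mx ord0 i) phi a| <= eta / N.
  near (0 : R)^'+ => d; exists d; first by near: d; exact: nbhs_right_gt.
  by near: d; apply: filter_forall => i; exact: near_a.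
near=> e => x y xa ya.
have ed : e <= d by near: e; exact: nbhs_right_le.
have [s /andP[s0 s1]] := MVT_line y (x - y) 0 dphi.
rewrite !mulr0 !addr0 [y + _]addrC subrK => ->.
set z := y + s *: (x - y); rewrite (derive_gradient (x - y) (dphi z)).
rewrite (derive_gradient (x - y) (dphi a)).
have za : `|z - a| <= d.
  have -> : z - a = s *: (x - a) + (1 - s) *: (y - a).
    by apply/rowP => j; rewrite !mxE; ring.
  apply: le_trans ed; apply: le_trans (ler_normD _ _) _; rewrite !normrZ.
  have s1' : 0 < 1 - s by rewrite subr_gt0.
  rewrite gtr0_norm // [`|1 - s|]gtr0_norm //.
  have -> : e = s * e + (1 - s) * e by ring.
  by rewrite lerD // ler_wpM2l // ltW.
rewrite /dot -sumrB; apply: le_trans (ler_norm_sum _ _ _) _.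
apply: (@le_trans _ _ (\sum_(i < n) eta / N * `|x - y|)).
  apply: ler_sum => i _; rewrite -mulrBl normrM ler_pM ?ler_mx_norm_entry //.
  by rewrite !mxE dP.
rewrite sumr_const card_ord -mulrnAl ler_wpM2r //.
rewrite -[_ *+ n]mulr_natr -mulrA ler_piMr ?(ltW eta0) // mulrC ler_pdivrMr // mul1r.
by rewrite ler_nat.
Unshelve. all: by end_near. Qed.

Lemma gradient_differentiable phi a : C2 phi -> differentiable (gradient phi) a.
Proof.
move=> [_ c1]; have -> : gradient phi =
    \sum_i (fun y => 'D_(delta_mx ord0 i) phi y *: (delta_mx ord0 i : 'rV[R]_n)).
  apply/funext => y; rewrite fct_sumE (row_sum_delta (gradient phi y)).
  by apply: eq_bigr => i _; rewrite mxE.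
by apply: differentiable_sum => i; apply: differentiableZl; case: (c1 (delta_mx ord0 i)).
Qed.

Lemma diff_hessian phi a u : C2 phi ->
  'd (gradient phi) a u = u *m hessian phi a.
Proof.
move=> /(gradient_differentiable a) dg.
by rewrite -deriveE // deriveEjacobian.
Qed.

(* The mean value theorem on [s |-> phi (a + s u) + s^2 k] gives a factor
   [s] in front of the quadratic form, of which only the sign matters. *)
Lemma second_order_lower phi a : C2 phi -> gradient phi a = 0 ->
  forall eta : R, 0 < eta -> \forall d \near 0^'+, forall u (k : R), `|u| <= d ->
  0 <= phi (a + u) - phi a + k ->
  0 <= dot (u *m hessian phi a) u + 2 * k + eta * `|u| ^+ 2.
Proof.
move=> phiC2 ga eta eta0; pose N : R := n.+1%:R.
have N0 : 0 < N by rewrite ltr0n.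
have dphi x : differentiable phi x by case: phiC2.
have /eqaddoP/(_ _ (divr_gt0 eta0 N0))/nbhs_normP[e /= e0 eP] :=
  diff_locally (gradient_differentiable a phiC2).
near=> d => u k ud.
have [s /andP[s0 s1] ->] := MVT_line a u k dphi.
rewrite derive_gradient // => H.
have ue : `|u| < e.
  by apply: le_lt_trans ud _; near: d; exact: nbhs_right_lt.
have se : `|s *: u| < e.
  by apply: le_lt_trans ue; rewrite normrZ gtr0_norm // ler_piMl // ltW.
have := eP (s *: u); rewrite /ball_ /= sub0r normrN => /(_ se).
rewrite !fctE /= ga add0r diff_hessian // -scalemxAl [s *: u + a]addrC.
set q := u *m _; set g := gradient _ _ in H *; rewrite normrZ gtr0_norm // => rP.
have gE : dot g u = s * dot q u + dot (g - s *: q) u.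
  rewrite /dot mulr_sumr -big_split /=; apply: eq_bigr => i _.
  by rewrite !mxE; ring.
have rB : dot (g - s *: q) u <= s * (eta * `|u| ^+ 2).
  apply: le_trans (ler_norm _) _; apply: le_trans (normr_dot _ _) _.
  apply: (@le_trans _ _ ((N * `|u|) * (eta / N * (s * `|u|)))).
    apply: ler_pM => //; first exact: sumr_ge0.
    apply: (@le_trans _ _ (\sum_(i < n) `|u|)).
      by apply: ler_sum => i _; exact: ler_mx_norm_entry.
    by rewrite sumr_const card_ord -mulr_natl ler_wpM2r // ler_nat.
  rewrite le_eqVlt; apply/orP; left; apply/eqP; field.
  by rewrite gt_eqF.
(* With the remainder bounded by [rB], every term carries the factor [s > 0]. *)
rewrite -(pmulr_rge0 _ s0); move: H; rewrite gE; lra.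
Unshelve. all: by end_near. Qed.

End MeanValue.

(** * Boundedness and strict differentiability of quadratic forms *)

Section QuadraticForms.
Context {R : realType}.

(** Both arguments are expanded in the standard basis, their entries being at most the norm. *)
Lemma rV_bilinear_bound (k : nat) (q : 'rV[R]_k -> 'rV[R]_k -> R) :
  (forall z, scalar (q ^~ z)) -> (forall z, scalar (q z)) ->
  exists2 C, 0 <= C & forall u v, `|q u v| <= C * `|u| * `|v|.
Proof.
move=> ql qr; pose b i : 'rV[R]_k := delta_mx ord0 i.
exists (\sum_i \sum_j `|q (b i) (b j)|).
  by apply: sumr_ge0 => i _; exact: sumr_ge0.
move=> u v; have -> : q u v = \sum_i \sum_j u ord0 i * v ord0 j * q (b i) (b j).
  rewrite {1}(row_sum_delta u) (scalar_sum _ _ _ (ql v)); apply: eq_bigr => i _.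
  rewrite {1}(row_sum_delta v) (scalar_sum _ _ _ (qr _)) mulr_sumr.
  by apply: eq_bigr => j _; rewrite mulrA.
rewrite -mulrA mulr_suml (le_trans (ler_norm_sum _ _ _)) // ler_sum // => i _.
rewrite mulr_suml (le_trans (ler_norm_sum _ _ _)) // ler_sum // => j _.
by rewrite 2!normrM mulrC ler_wpM2l // ler_pM // ler_mx_norm_entry.
Qed.

Lemma bilinear_diag_dist (X : normedModType R) (q : X -> X -> R) (C : R) :
  (forall z, scalar (q ^~ z)) -> (forall z, scalar (q z)) ->
  (forall u v, `|q u v| <= C * `|u| * `|v|) ->
  forall u v, `|q u u - q v v| <= C * `|u - v| * (`|u| + `|v|).
Proof.
move=> ql qr qC u v.
have -> : q u u - q v v = q (u - v) u + q v (u - v).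
  have := qr v (-1) v u; have := ql u (-1) v u.
  rewrite !scaleN1r ![- v + u]addrC => -> ->; ring.
rewrite mulrDr (le_trans (ler_normD _ _)) // lerD //.
by rewrite mulrAC.
Qed.

(** The error is exactly [q (a - b) ((a - x0) + (b - x0))], whose second argument has norm at most
    [2 d]. *)
Lemma quadratic_strictly_differentiable (X : normedModType R) (q : X -> X -> R)
    (C : R) (x0 : X) : (forall z, scalar (q ^~ z)) -> (forall u v, q u v = q v u) ->
  0 <= C -> (forall u v, `|q u v| <= C * `|u| * `|v|) ->
  strictly_differentiable (fun u => q u u) (fun u => 2 * q x0 u) x0.
Proof.
move=> ql qC C0 qB eta eta0.
have C2 : 0 < 2 * (C + 1) by rewrite mulr_gt0 // ltr_wpDl.
near=> d => a b ad bd.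
have qr z : scalar (q z) by move=> k u v; rewrite !(qC z) ql.
have -> : q a a - q b b - 2 * q x0 (a - b) = q (a - b) ((a - x0) + (b - x0)).
  have e1 y : q (a - b) y = q a y - q b y.
    by have := ql y (-1) b a; rewrite !scaleN1r [- b + a]addrC => ->; ring.
  have e2 y z : q y (z - x0) = q y z - q y x0.
    by have := qr y (-1) x0 z; rewrite !scaleN1r [- x0 + z]addrC => ->; ring.
  have e3 y z t : q y (z + t) = q y z + q y t.
    by have := qr y 1 z t; rewrite !scale1r mul1r.
  by rewrite (qC x0) (e3 _ (a - x0)) !e2 !e1 (qC a b); ring.
apply: le_trans (qB _ _) _; rewrite mulrAC ler_wpM2r //.
apply: (@le_trans _ _ (C * (d + d))).
  by rewrite ler_wpM2l // (le_trans (ler_normD _ _)) // lerD.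
have d0 : 0 < d by near: d; exact: nbhs_right_gt.
have : d * (2 * (C + 1)) <= eta.
  rewrite -ler_pdivlMr //; near: d; apply: nbhs_right_le.
  exact: divr_gt0.
have -> : C * (d + d) = d * (2 * (C + 1)) - 2 * d by ring.
by move: (d * _) => c; lra.
Unshelve. all: by end_near. Qed.

Lemma strictly_differentiable_sum (X Y : normedModType R) (F A : X -> R)
    (G B : Y -> R) (x0 : X) (y0 : Y) :
  strictly_differentiable F A x0 -> strictly_differentiable G B y0 ->
  strictly_differentiable (fun p : X * Y => F p.1 + G p.2)
    (fun p => A p.1 + B p.2) (x0, y0).
Proof.
move=> dF dG eta eta0; have e20 : 0 < eta / 2 by rewrite divr_gt0.
have hX (p : X * Y) : `|p.1| <= `|p| by rewrite prod_normE le_max lexx.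
have hY (p : X * Y) : `|p.2| <= `|p| by rewrite prod_normE le_max lexx orbT.
apply: filterS2 (dF _ e20) (dG _ e20) => d Fd Gd a b ad bd.
have H1 := Fd _ _ (le_trans (hX (a - (x0, y0))) ad) (le_trans (hX (b - (x0, y0))) bd).
have H2 := Gd _ _ (le_trans (hY (a - (x0, y0))) ad) (le_trans (hY (b - (x0, y0))) bd).
rewrite (_ : _ - _ = (F a.1 - F b.1 - A (a.1 - b.1)) + (G a.2 - G b.2 - B (a.2 - b.2))).
  apply: le_trans (ler_normD _ _) _.
  apply: le_trans (lerD H1 H2) _.
  rewrite [in leRHS](splitr eta) mulrDl lerD // ler_wpM2l ?(ltW e20) //.
    exact: (hX (a - b)).
  exact: (hY (a - b)).
by rewrite /=; ring.
Qed.

End QuadraticForms.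

(** * Regularity of the equations with a slack variable *)

Section Slack.
Context {R : realType} {n m : nat} {E : euclideanJordanType R}.
Variables (h : 'rV[R]_n -> 'rV[R]_m) (g : 'rV[R]_n -> E).
Hypotheses (h_C1 : C1 h) (g_C1 : C1 g).

Let k := \dim {:E}.

(** The slack variable is kept in coordinates, where [rV_bilinear_bound] bounds the forms in which
    it occurs. *)
Definition of_coord (u : 'rV[R]_k) : E := \sum_l u ord0 l *: (vbasis {:E})`_l.

Lemma of_coord_linear : linear of_coord.
Proof.
move=> a u v; rewrite /of_coord scaler_sumr -big_split /=.
by apply: eq_bigr => l _; rewrite !mxE scalerDl scalerA.
Qed.

Lemma of_coord_surj y : exists u, of_coord u = y.
Proof.
exists (\row_l coord (vbasis {:E}) l y); rewrite [RHS](coord_vbasis (memvf y)).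
by apply: eq_bigr => l _; rewrite mxE.
Qed.

(** Inner product through which [slack = 0] becomes finitely many scalar equations. *)
Definition pairing (a P : 'rV[R]_m * E) : R := dot a.1 P.1 + jdot a.2 P.2.

Lemma pairingC a P : pairing a P = pairing P a.
Proof.
rewrite /pairing jdotC; congr (_ + _).
by apply: eq_bigr => i _; rewrite mulrC.
Qed.

Lemma pairing_scalarl P : scalar (pairing ^~ P).
Proof.
move=> a u v; rewrite /pairing /= jdotDl jdotZl.
have := dotr_is_linear P.1 a u.1 v.1; rewrite /dotr => ->.
by rewrite /GRing.scale /=; ring.
Qed.

Lemma pairing_scalarr a : scalar (pairing a).
Proof. by move=> c u v; rewrite !(pairingC a) pairing_scalarl. Qed.

Lemma pairing_eq0 a : pairing a a = 0 -> a = 0.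
Proof.
rewrite /pairing => /eqP; rewrite paddr_eq0 ?jdot_ge0 //; last first.
  by apply: sumr_ge0 => i _; rewrite -expr2 sqr_ge0.
rewrite psumr_eq0 => [|i _]; last by rewrite -expr2 sqr_ge0.
case/andP => /allP a1 /eqP/jdot_eq0 a2; case: a a1 a2 => a1 a2 /= H ->.
congr (_, _); apply/rowP => i; rewrite mxE.
have := H i (mem_index_enum i); rewrite /= mulf_eq0 orbb.
by move/eqP.
Qed.

Definition slack (X : 'rV[R]_n * 'rV[R]_k) : 'rV[R]_m * E :=
  (h X.1, g X.1 - of_coord X.2 \o_J of_coord X.2).

(** Derivative of [slack] at [(x, u)] for [y = of_coord u]: the base point [y] lies in [E], the
    direction is in coordinates. *)
Definition dslack (x : 'rV[R]_n) (y : E) (X : 'rV[R]_n * 'rV[R]_k) :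
    'rV[R]_m * E :=
  ('D_X.1 h x, 'D_X.1 g x - 2 *: (y \o_J of_coord X.2)).

Let phi (P : 'rV[R]_m * E) := (dotr P.1 \o h) + (jdotr P.2 \o g).

Let phi_C1 P : C1 (phi P).
Proof.
apply: C1D; first by apply: (C1_comp_linear (T := dotr P.1)) => //; exact: dotr_continuous.
by apply: (C1_comp_linear (T := jdotr P.2)) => //; exact: jdotr_continuous.
Qed.

Let phi_derive P x d : 'D_d (phi P) x = dot ('D_d h x) P.1 + jdot ('D_d g x) P.2.
Proof.
have dh : differentiable h x by case: h_C1.
have dg : differentiable g x by case: g_C1.
have ch := @dotr_continuous R m P.1; have cg := @jdotr_continuous R E P.2.
rewrite deriveD.
- by rewrite (derive_comp_linear _ ch dh) (derive_comp_linear _ cg dg).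
- exact: diff_derivable (differentiable_comp_linear ch dh).
- exact: diff_derivable (differentiable_comp_linear cg dg).
Qed.

(** Each scalar component is the C1 function [phi P] of the first variable plus a quadratic form in
    the second. *)
Lemma slack_strictly_differentiable x u P :
  strictly_differentiable (fun X => pairing (slack X) P)
    (fun X => pairing (dslack x (of_coord u) X) P) (x, u).
Proof.
pose q u v := - jdot (of_coord u \o_J of_coord v) P.2.
have ql z : scalar (q ^~ z).
  move=> a s t; rewrite /q of_coord_linear jmulDl jmulZl jdotDl jdotZl; ring.
have qC s t : q s t = q t s by rewrite /q jmulC.
have qr z : scalar (q z) by move=> a s t; rewrite !(qC z) ql.
have [C C0 qB] := rV_bilinear_bound ql qr.
have H := strictly_differentiable_sum (C1_strictly_differentiable x (phi_C1 P))
  (quadratic_strictly_differentiable u ql qC C0 qB).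
move: H; congr strictly_differentiable; apply/funext => X.
  by rewrite /pairing /slack /= jdotDl jdotNl addrA.
rewrite phi_derive /pairing /dslack /= jdotDl jdotNl jdotZl /q.
by rewrite mulrN addrA.
Qed.

Lemma dslack_linear x y : linear (dslack x y).
Proof.
have dh : differentiable h x by case: h_C1.
have dg : differentiable g x by case: g_C1.
move=> a X X'; rewrite /dslack /= !deriveE // !linearP of_coord_linear.
congr (_, _); rewrite /= jmulDr jmulZr scalerBr scalerDr opprD addrACA.
by rewrite !scalerA [2 * a]mulrC.
Qed.

(** Varying the slack variable forces [y \o_J P.2 = 0], so [P.2] is orthogonal to the lineality
    space. Nondegeneracy writes [P] as a derivative of [(h, g)] plus a lineality element, both
    orthogonal to [P]. *)
Lemma nondegenerate_dslack x P : nondegenerate_point h g x ->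
  (forall X, pairing (dslack x (jsqrt (g x)) X) P = 0) -> P = 0.
Proof.
have dh : differentiable h x by case: h_C1.
have dg : differentiable g x by case: g_C1.
move=> [Kz nd] H; set y := jsqrt (g x) in H *.
have yP : y \o_J P.2 = 0.
  (* The direction [y \o_J P.2] itself is tested, which yields its squared norm. *)
  apply: jdot_eq0; have [u uE] := of_coord_surj (y \o_J P.2).
  have := H (0, u); rewrite /pairing /dslack /= !derive0 uE sub0r jdotNl jdotZl.
  have -> : dot (0 : 'rV[R]_m) P.1 = 0.
    by rewrite /dot big1 // => i _; rewrite mxE mul0r.
  rewrite jmulC jdot_assoc; lra.
have : [set: 'rV[R]_m * E] P by [].
rewrite nd => -[_ [d _ <-]] [[p0 l] /= [-> Tl]] PE.
apply: pairing_eq0; rewrite -[X in pairing X]PE.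
have := H (d, 0); rewrite /pairing /dslack /= !deriveE // => H0.
have := ker_jsqrt_lineality Kz yP Tl; rewrite addr0 jdotDl => ->.
rewrite addr0 -H0; congr (_ + jdot _ _).
by rewrite /of_coord big1 ?jmulx0 ?scaler0 ?subr0 // => i _; rewrite mxE scale0r.
Qed.

(* Nondegeneracy makes the slack equation [h x = 0, g x = y o y] regular. *)
Lemma slack_tangent x u v w : nondegenerate_point h g x ->
  of_coord u = jsqrt (g x) -> slack (x, u) = 0 ->
  dslack x (jsqrt (g x)) (v, w) = 0 ->
  forall eps : R, 0 < eps -> \forall t \near 0^'+,
    exists v' w', [/\ `|v' - v| <= eps, `|w' - w| <= eps &
                      slack (x + t *: v', u + t *: w') = 0].
Proof.
move=> nd uE s0 ds0 eps eps0; pose e := vbasis {: ('rV[R]_m * E)%type}.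
pose F i X := pairing (slack X) e`_i.
pose A i X := pairing (dslack x (of_coord u) X) e`_i.
have pair0 a : (forall i : 'I_(\dim {: ('rV[R]_m * E)%type}), pairing a e`_i = 0) -> a = 0.
  move=> a0; apply: pairing_eq0; rewrite {2}(coord_vbasis (memvf a)).
  rewrite (scalar_sum _ _ _ (pairing_scalarr a)) big1 // => i _.
  by rewrite a0 mulr0.
have lA i : scalar (A i).
  by move=> a X X'; rewrite /A dslack_linear pairing_scalarl.
have freeA (r : 'rV[R]_(\dim {: ('rV[R]_m * E)%type})) :
    (forall X, \sum_i r ord0 i * A i X = 0) -> r = 0.
  (* A vanishing combination of the [A i] is a vector orthogonal to the range of [dslack]. *)
  move=> rA; have P0 : \sum_i r ord0 i *: e`_i = 0.
    apply: (nondegenerate_dslack nd) => X; rewrite -uE.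
    by rewrite (scalar_sum _ _ _ (pairing_scalarr _)); exact: rA.
  apply/rowP => i; rewrite mxE.
  by have /freeP := basis_free (vbasisP {: ('rV[R]_m * E)%type}); apply.
have [beta Abeta] := dual_family lA freeA.
have sF i : strictly_differentiable (F i) (A i) (x, u).
  exact: slack_strictly_differentiable.
have F0 i : F i (x, u) = 0.
  by rewrite /F s0 /pairing jdot0x addr0 /dot big1 // => j _; rewrite mxE mul0r.
have AV i : A i (v, w) = 0.
  rewrite /A uE ds0 /pairing jdot0x addr0 /dot big1 // => j _.
  by rewrite mxE mul0r.
have := lyusternik lA sF F0 AV Abeta eps0.
apply: filterS => t [[v' w']]; rewrite prod_normE ge_max => /andP[/= ve we] H.
by exists v', w'; split => //; apply: pair0 => i; exact: H.
Qed.

End Slack.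

(** * The Lagrangian and the passage to the limit along feasible points *)

Lemma C2_lagrangian (R : realType) (n m : nat) (E : euclideanJordanType R)
    (f : 'rV[R]_n -> R) (h : 'rV[R]_n -> 'rV[R]_m) (g : 'rV[R]_n -> E)
    (mu : 'rV[R]_m) (lambda : E) : C2 f -> C2 h -> C2 g ->
  C2 (fun y => lagrangian f h g y mu lambda).
Proof.
move=> f2 h2 g2.
(* The signs move into the multipliers, so that sums and linear compositions suffice. *)
have -> : (fun y => lagrangian f h g y mu lambda) =
    f + (dotr (- mu) \o h) + (jdotr (- lambda) \o g).
  apply/funext => y; rewrite /lagrangian !fctE /= /jdotr jdotNr; congr (_ + _ - _).
  rewrite /dotr /dot -sumrN; apply: eq_bigr => i _.
  by rewrite mxE mulrN.
have mu2 := C2_comp_linear (@dotr_continuous R m (- mu)) h2.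
have la2 := C2_comp_linear (@jdotr_continuous R E (- lambda)) g2.
exact: (C2D (C2D f2 mu2) la2).
Qed.

Lemma kkt_gradient (R : realType) (n m : nat) (E : euclideanJordanType R)
    (f : 'rV[R]_n -> R) (h : 'rV[R]_n -> 'rV[R]_m) (g : 'rV[R]_n -> E)
    (x : 'rV[R]_n) (mu : 'rV[R]_m) (lambda : E) :
  differentiable f x -> differentiable h x -> differentiable g x ->
  kkt_triple f h g x mu lambda ->
  gradient (fun y => lagrangian f h g y mu lambda) x = 0.
Proof.
move=> df dh dg [gE _ _ _ _]; rewrite -gE; apply/rowP => i; rewrite !mxE.
set d := delta_mx ord0 i.
have dmu : differentiable (dotr mu \o h) x.
  exact: (differentiable_comp_linear (@dotr_continuous _ _ mu) dh).
have dla : differentiable (jdotr lambda \o g) x.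
  exact: (differentiable_comp_linear (@jdotr_continuous _ _ lambda) dg).
have -> : (fun y => lagrangian f h g y mu lambda) =
    f - (dotr mu \o h) - (jdotr lambda \o g) by [].
rewrite deriveB; last 2 first.
- by apply: diff_derivable; apply: differentiableB.
- exact: diff_derivable.
rewrite deriveB; [|exact: diff_derivable|exact: diff_derivable].
rewrite (derive_comp_linear _ (@dotr_continuous _ _ mu) dh).
rewrite (derive_comp_linear _ (@jdotr_continuous _ _ lambda) dg).
by rewrite !deriveE.
Qed.

Theorem proposition6p2 (R : realType) (n m : nat) (E : euclideanJordanType R)
    (f : 'rV[R]_n -> R) (h : 'rV[R]_n -> 'rV[R]_m) (g : 'rV[R]_n -> E)
    (f_C2 : C2 f) (h_C2 : C2 h) (g_C2 : C2 g)
    (x : 'rV[R]_n) (mu : 'rV[R]_m) (lambda : E)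
    (x_min : local_minimum f h g x)
    (x_kkt : kkt_triple f h g x mu lambda)
    (x_nondeg : nondegenerate_point h g x) :
  forall (v : 'rV[R]_n) (w : E),
    'd g x v - (2 *: jsqrt (g x)) \o_J w = 0 ->
    'd h x v = 0 ->
    0 <= dot (v *m hessian (fun y => lagrangian f h g y mu lambda) x) v
         + 2 * jdot (w \o_J w) lambda.
Proof.
move=> v w gv hv.
have [dh dg] : differentiable h x /\ differentiable g x.
  by case: h_C2 => + _; case: g_C2.
rewrite -deriveE // in gv; rewrite -deriveE // in hv.
have gradL : gradient (fun y => lagrangian f h g y mu lambda) x = 0.
  by apply: kkt_gradient => //; case: f_C2.
have [_ _ Kz lz hx0] := x_kkt; have [_ fmin] := x_min.
have L2 := C2_lagrangian mu lambda f_C2 h_C2 g_C2.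
have second := second_order_lower L2 gradL.
set H := hessian _ x in second *; set y := jsqrt (g x) in gv.
have yy : y \o_J y = g x by exact: jsqrt_sqr.
have yl : y \o_J lambda = 0 by apply: (proj1 (jsqrt_ker lambda Kz)); rewrite jmulC.
have [u uE] := of_coord_surj y; have [z zE] := of_coord_surj w.
have s0 : slack h g (x, u) = 0 by rewrite /slack /= hx0 uE yy subrr.
have ds0 : dslack h g x y (v, z) = 0.
  by rewrite /dslack /= hv zE -jmulZl gv.
have tang := slack_tangent (C2_C1 h_C2) (C2_C1 g_C2) x_nondeg uE s0 ds0.
pose q1 (a b : 'rV[R]_n) := dot (a *m H) b.
pose q2 a b : R := jdot (@of_coord R E a \o_J of_coord b) lambda.
have lin2 c : scalar (q2 ^~ c).
  by move=> k a b; rewrite /q2 of_coord_linear jmulDl jmulZl jdotDl jdotZl.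
have lin2' c : scalar (q2 c).
  by move=> k a b; rewrite /q2 of_coord_linear jmulDr jmulZr jdotDl jdotZl.
have [B2 B20 q2B] := rV_bilinear_bound lin2 lin2'.
have lin1 c : scalar (q1 ^~ c).
  move=> k a b; rewrite /q1 /dot mulmxDl -scalemxAl mulr_sumr -big_split /=.
  by apply: eq_bigr => i _; rewrite !mxE; ring.
have lin1' c : scalar (q1 c).
  move=> k a b; rewrite /q1 /dot mulr_sumr -big_split /=.
  by apply: eq_bigr => i _; rewrite !mxE; ring.
have [B1 B10 q1B] := rV_bilinear_bound lin1 lin1'.
have -> : jdot (w \o_J w) lambda = q2 z z by rewrite /q2 zE.
rewrite -/(q1 v v).
(* Total error per unit of [eps] in replacing [(v', z')] by [(v, z)]; since [eps <= 1], the sum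
   [|v'| + |v|] is at most [2 |v| + 1], and likewise for [z]. *)
pose K := B1 * (2 * `|v| + 1) + 2 * (B2 * (2 * `|z| + 1)) + (`|v| + 1) ^+ 2.
have K0 : 0 < K.
  rewrite ltr_wpDl ?exprn_gt0 ?ltr_wpDl //.
  by rewrite addr_ge0 ?mulr_ge0 ?addr_ge0 ?mulr_ge0.
suff approx (eps : R) : 0 < eps -> eps <= 1 -> 0 <= q1 v v + 2 * q2 z z + eps * K.
  apply/ler_addgt0Pl => e e0.
  have m0 : 0 < Num.min 1 (e / K) by rewrite lt_min ltr01 divr_gt0.
  have m1 : Num.min 1 (e / K) <= 1 by rewrite ge_min lexx.
  have meK : Num.min 1 (e / K) * K <= e by rewrite -ler_pdivlMr // ge_min lexx orbT.
  by have := approx _ m0 m1; move: meK; set t := _ * K; lra.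
move=> eps0 eps1.
have /nbhs_normP[r /= r0 rP] := fmin.
have v1 : 0 < `|v| + 1 by rewrite ltr_wpDl.
have [d [d0 [dr dP]]] : exists d : R, 0 < d /\ d < r /\
    forall a (k : R), `|a| <= d ->
    0 <= lagrangian f h g (x + a) mu lambda - lagrangian f h g x mu lambda + k ->
    0 <= dot (a *m H) a + 2 * k + eps * `|a| ^+ 2.
  near (0 : R)^'+ => d; exists d; split; first by near: d; exact: nbhs_right_gt.
  split; first by near: d; exact: nbhs_right_lt.
  by near: d; exact: second.
have [t [t0 [td [v' [z' [vv' zz' s']]]]]] : exists t : R, 0 < t /\ t <= d / (`|v| + 1) /\
    exists v' z', [/\ `|v' - v| <= eps, `|z' - z| <= eps &
                      slack h g (x + t *: v', u + t *: z') = 0].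
  near (0 : R)^'+ => t; exists t; split; first by near: t; exact: nbhs_right_gt.
  split; first by near: t; apply: nbhs_right_le; rewrite divr_gt0.
  by near: t; exact: tang.
have nv' : `|v'| <= `|v| + 1.
  rewrite -[v'](subrK v) addrC (le_trans (ler_normD _ _)) // lerD2l.
  exact: le_trans eps1.
have nz' : `|z'| <= `|z| + 1.
  rewrite -[z'](subrK z) addrC (le_trans (ler_normD _ _)) // lerD2l.
  exact: le_trans eps1.
have tv : `|t *: v'| <= d.
  rewrite normrZ gtr0_norm //; move: td; rewrite ler_pdivlMr //.
  by apply: le_trans; rewrite ler_wpM2l // ltW.
case: s' => hx' /eqP; rewrite subr_eq0 => /eqP gx'.
have feas : feasible h g (x + t *: v').
  by split => //; exists (of_coord (u + t *: z')).
have fle : f x <= f (x + t *: v').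
  apply: rP feas => /=; rewrite opprD addrA subrr sub0r normrN.
  exact: le_lt_trans dr.
(* Removes the term linear in [t] when the square is expanded. *)
have yz' : jdot (y \o_J of_coord z') lambda = 0.
  by rewrite jmulC jdot_assoc yl jdotx0.
(* This [k] offsets the change of [jdot (g _) lambda], so the premise reduces to
   [f x <= f (x + t *: v')]. *)
have := dP (t *: v') (t ^+ 2 * q2 z' z') tv.
rewrite /lagrangian hx' hx0 gx'.
have -> : of_coord (u + t *: z') = y + t *: of_coord z'.
  by rewrite addrC of_coord_linear uE addrC.
have -> : jdot ((y + t *: of_coord z') \o_J (y + t *: of_coord z')) lambda =
    jdot (g x) lambda + t ^+ 2 * q2 z' z'.
  rewrite jmulDl !jmulDr !jmulZl !jmulZr yy [_ \o_J y]jmulC.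
  by rewrite !jdotDl !jdotZl yz' /q2; ring.
set c1 := dot 0 mu; set c2 := jdot _ _; set c3 := _ * q2 _ _ => Hk.
have {Hk} : 0 <= t ^+ 2 * (q1 v' v' + 2 * q2 z' z' + eps * `|v'| ^+ 2).
  have : 0 <= dot (t *: v' *m H) (t *: v') + 2 * c3 + eps * `|t *: v'| ^+ 2.
    by apply: Hk; lra.
  rewrite normrZ gtr0_norm // -scalemxAl.
  have -> : dot (t *: (v' *m H)) (t *: v') = t ^+ 2 * q1 v' v'.
    by rewrite /q1 /dot mulr_sumr; apply: eq_bigr => i _; rewrite !mxE; ring.
  by rewrite /c3; congr (0 <= _); ring.
rewrite pmulr_rge0 ?exprn_gt0 // => Q'.
have D1 := bilinear_diag_dist lin1 lin1' q1B v' v.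
have D2 := bilinear_diag_dist lin2 lin2' q2B z' z.
have E1 : q1 v' v' - q1 v v <= eps * (B1 * (2 * `|v| + 1)).
  apply: le_trans (ler_norm _) (le_trans D1 _).
  rewrite mulrA [eps * B1]mulrC; apply: ler_pM => //.
  - exact: mulr_ge0.
  - exact: ler_wpM2l.
  - by move: nv'; lra.
have E2 : q2 z' z' - q2 z z <= eps * (B2 * (2 * `|z| + 1)).
  apply: le_trans (ler_norm _) (le_trans D2 _).
  rewrite mulrA [eps * B2]mulrC; apply: ler_pM => //.
  - exact: mulr_ge0.
  - exact: ler_wpM2l.
  - by move: nz'; lra.
have E3 : eps * `|v'| ^+ 2 <= eps * (`|v| + 1) ^+ 2.
  by rewrite ler_pM2l // ler_pXn2r // nnegrE ?addr_ge0.
apply: le_trans Q' _; rewrite /K; move: E1 E2 E3; lra.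
Unshelve. all: by end_near. Qed.
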